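(* \begin{equation*} \Gamma_{i}^{\left[\substack{s\\ s+1}\right]\times i} = \begin{cases} 2^{2s+2i-1} - 3\cdot 2^{3i-4} + 2^{2i-3} & \text{if } 1\leq i\leq s+1,\\ 2^{2s+2i-2} - 3\cdot 2^{3i-4} + 2^{4i-2s-6} & \text{if } s+2\leq i\leq 2s+1. \end{cases} \end{equation*}
   Context: $\Gamma_{i}^{\left[\substack{s\\ s+1}\right]\times k}$ denotes the number of rank $i$ matrices over $\mathbb{F}_2$ of the form $\left[\frac{A}{B}\right]$ where $A$ is an $s\times k$ persymmetric matrix and $B$ an $(s+1)\times k$ persymmetric matrix over $\mathbb{F}_2$; here $k=i$.
   Formalization: In the second case (s+2 ≤ i ≤ 2s+1) the leading term is 2^{2s+2i-1} instead of the printed 2^{2s+2i-2}; the printed formula is false (for s=1, i=3 it gives −16, while the count is 48). *)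

(* Defs.v *)
From mathcomp Require Export all_boot all_order all_algebra.

Set Implicit Arguments.
Unset Strict Implicit.
Unset Printing Implicit Defensive.

Import GRing.Theory.

(* "Persymmetric" is meant for rectangular matrices, in the Hankel sense:
   entries are constant along each antidiagonal (i + j constant). *)
Definition persymmetric (m n : nat) (A : 'M['F_2]_(m, n)) : bool :=
  [forall i1 : 'I_m, forall j1 : 'I_n, forall i2 : 'I_m, forall j2 : 'I_n,
     (i1 + j1 == i2 + j2)%N ==> (A i1 j1 == A i2 j2)].

Definition Gamma (s t k i : nat) : nat :=
  #|[set M : 'M['F_2]_(s + t, k) |
       [&& persymmetric (usubmx M), persymmetric (dsubmx M) & \rank M == i]]|.

(* Main.v *)
(** A row vector [b] of length [L] is a linear functional on the polynomials of size
    at most [L].  The row kernel of its Hankel matrix with [k] rows and [L + 1 - k]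
    columns consists of the annihilators of [b] of size at most [k], i.e. the [v]
    such that [b] vanishes on [v X^j] for [j + k <= L].  If [r] is least such that a
    nonzero annihilator of size at most [r + 1] exists, these kernels are
    [f S_(k-r) (+) g S_(k-R)] with [R = L + 1 - r] and [S_m] the polynomials of size
    at most [m] (Sylvester's description of the apolar ideal of a binary form).  The
    dimensions come from two facts: they increase convexly with [k], and the Hankel
    matrices with [k] and [L + 1 - k] rows are transposed.  Over a field with [q]
    elements, the first moment of the kernel size gives [q ^ min(2j, L)] functionals
    with [r <= j].

    The pairs [(a, b)] without common annihilator are counted by fixing [b].  The
    functional [a] has to be injective on the kernel of [b], which is a condition on
    its contractions by [f] and [g], so the number of such [a] depends only on [r].
    For few columns only [f] occurs, and the sum over [b] is again a first moment.
    Replacing [(t, k, r)] by [(t+2, k+2, r+2)] multiplies the number of [b] by [q^4]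
    and the number of [a] by [q^2]; together with the symmetry in [a] and [b], the
    count for [(s, s+1, k)] is [q^6] times the one for [(s-1, s, k-2)]. *)
From HB Require Import structures.
Require Import Defs.
From mathcomp Require Import all_boot all_order all_algebra.
From mathcomp Require Import mxabelem zify.

Set Implicit Arguments.
Unset Strict Implicit.
Unset Printing Implicit Defensive.

Import GRing.Theory Num.Theory.
Local Open Scope ring_scope.

Lemma sub_mulmxP (F : fieldType) m n p (A : 'M[F]_(m, n)) (B : 'M_(n, p)) (v : 'rV_p) :
  reflect (exists2 u : 'rV_n, (u <= A)%MS & v = u *m B) (v <= A *m B)%MS.
Proof.
apply: (iffP submxP) => [[w ->]|[_ /submxP[w ->] ->]].
  by exists (w *m A); rewrite ?submxMl ?mulmxA.
by exists w; rewrite mulmxA.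
Qed.

Lemma row_free_row_mx (F : fieldType) m n1 n2 p (A : 'M[F]_(m, n1)) (B : 'M_(m, n2))
    (G : 'M_(p, m)) : row_free G -> (kermx B :=: G)%MS ->
  row_free (row_mx A B) = row_free (G *m A).
Proof.
move=> Gfree kerB; apply/idP/idP => free; apply: inj_row_free => v.
  rewrite mulmxA => vGA; apply: (row_free_inj Gfree); apply: (row_free_inj free).
  rewrite !mul0mx mul_mx_row vGA (_ : v *m G *m B = 0) ?row_mx0 //.
  by apply/sub_kermxP; rewrite kerB submxMl.
rewrite mul_mx_row => /eqP; rewrite row_mx_eq0 => /andP[/eqP vA /eqP/sub_kermxP].
rewrite kerB => /submxP[w vE]; rewrite vE (_ : w = 0) ?mul0mx //.
by apply: (row_free_inj free); rewrite mul0mx mulmxA -vE.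
Qed.

Lemma row_free_row_mxC (F : fieldType) m n1 n2 (A : 'M[F]_(m, n1)) (B : 'M_(m, n2)) :
  row_free (row_mx A B) = row_free (row_mx B A).
Proof. by rewrite /row_free -!(mxrank_tr (row_mx _ _)) !tr_row_mx -!addsmxE addsmxC. Qed.

Lemma submx_adds_row (F : fieldType) m1 m2 n (A : 'M[F]_(m1, n)) (B : 'M[F]_(m2, n)) :
  (A <= B)%MS -> (\rank B = (\rank A).+1)%N -> exists v : 'rV_n, (B <= A + v)%MS.
Proof.
move=> AB rkB; have /row_subPn[i iA] : ~~ (B <= A)%MS.
  by apply: contraTN (leqnn (\rank B)) => /mxrankS; rewrite rkB ltnn.
exists (row i B).
have AvB : (A + row i B <= B)%MS by rewrite addsmx_sub AB row_sub.
rewrite -(geq_leqif (mxrank_leqif_sup AvB)) rkB ltnNge; apply: contra iA.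
by rewrite (geq_leqif (mxrank_leqif_sup (addsmxSl _ _))) addsmx_sub => /andP[].
Qed.

(** * Hankel matrices and annihilators *)

Section Functionals.
Variable F : fieldType.
Implicit Types (p q w : {poly F}) (L m n k : nat).

Definition ev L (b : 'rV[F]_L) p : F := \sum_(i < L) b 0 i * p`_i.

Lemma ev_is_scalar L (b : 'rV[F]_L) : scalar (ev b).
Proof.
move=> c p q; rewrite mulr_sumr -big_split; apply: eq_bigr => i _ /=.
by rewrite coefD coefZ mulrDr mulrCA.
Qed.

HB.instance Definition _ L (b : 'rV[F]_L) :=
  GRing.isLinear.Build F {poly F} F *%R (ev b) (ev_is_scalar b).

Lemma ev_Xn L (b : 'rV[F]_L) (i : 'I_L) : ev b 'X^i = b 0 i.
Proof.
rewrite /ev (bigD1 i) //= coefXn eqxx mulr1 big1 ?addr0 // => j ji.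
by rewrite coefXn (inj_eq val_inj) (negPf ji) mulr0.
Qed.

Lemma rVpoly_inj n : injective (@rVpoly F n).
Proof. exact: can_inj (@rVpolyK F n). Qed.

Lemma rVpoly_eq0 n (v : 'rV[F]_n) : (rVpoly v == 0) = (v == 0).
Proof. by rewrite -(inj_eq (@rVpoly_inj n)) linear0. Qed.

Lemma size_rVpoly n (v : 'rV[F]_n) : (size (rVpoly v) <= n)%N.
Proof. exact: size_poly. Qed.

Lemma rVpoly_sum n (v : 'rV[F]_n) : rVpoly v = \sum_i v 0 i *: 'X^i.
Proof.
rewrite {1}(row_sum_delta v) linear_sum; apply: eq_bigr => i _.
by rewrite linearZ /= rVpoly_delta.
Qed.

Lemma size_mul_leq p q m n k :
  (size p <= m)%N -> (size q <= n)%N -> (m + n <= k.+1)%N -> (size (p * q)%R <= k)%N.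
Proof. by move=> pm qn mnk; have := size_polyMleq p q; lia. Qed.

Definition mulp_mx p m n : 'M[F]_(m, n) := lin1_mx (poly_rV \o p \o* rVpoly).

Lemma mul_rV_mulp p m n (v : 'rV[F]_m) : v *m mulp_mx p m n = poly_rV (rVpoly v * p).
Proof. exact: mul_rV_lin1. Qed.

Lemma rVpoly_mulp p m n (v : 'rV[F]_m) :
  (size p + m <= n.+1)%N -> rVpoly (v *m mulp_mx p m n) = rVpoly v * p.
Proof.
move=> pmn; rewrite mul_rV_mulp poly_rV_K //.
by apply: size_mul_leq (size_rVpoly v) (leqnn _) _; rewrite addnC.
Qed.

Lemma mulp_mx_free p m n : p != 0 -> (size p + m <= n.+1)%N -> row_free (mulp_mx p m n).
Proof.
move=> p0 pmn; apply: inj_row_free => v /(congr1 rVpoly).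
rewrite rVpoly_mulp // linear0 => /eqP.
by rewrite mulf_eq0 (negPf p0) orbF rVpoly_eq0 => /eqP.
Qed.

Lemma sub_mulpP p m n (v : 'rV[F]_n) : (size p + m <= n.+1)%N ->
  reflect (exists2 w : {poly F}, (size w <= m)%N & rVpoly v = w * p) (v <= mulp_mx p m n)%MS.
Proof.
move=> pmn; apply: (iffP submxP) => [[w ->]|[w wm vE]].
  by exists (rVpoly w); rewrite ?size_rVpoly ?rVpoly_mulp.
by exists (poly_rV w); apply: rVpoly_inj; rewrite rVpoly_mulp // poly_rV_K.
Qed.

Lemma mulp_mulp_sub p q m n : (size p + m <= n.+1)%N -> (size q <= 2)%N ->
  (mulp_mx p m n *m mulp_mx q n n.+1 <= mulp_mx p m.+1 n.+1)%MS.
Proof.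
move=> pmn q2; apply/rV_subP => _ /sub_mulmxP[v /(sub_mulpP _ pmn)[w wm vE] ->].
apply/sub_mulpP; first by rewrite addnS.
exists (w * q); first by apply: size_mul_leq wm q2 _; rewrite addn2.
by rewrite rVpoly_mulp ?vE 1?mulrAC //; lia.
Qed.

Definition contract p n L (b : 'rV[F]_L) : 'rV[F]_n := \row_j ev b (p * 'X^j).

Lemma contractE p n L (b : 'rV[F]_L) : contract p n b = b *m (mulp_mx p n L)^T.
Proof.
apply/rowP => j; rewrite !mxE; apply: eq_bigr => i _.
by rewrite !mxE /= rVpoly_delta [p * _]mulrC.
Qed.

Lemma ev_contract p n L (b : 'rV[F]_L) w :
  (size w <= n)%N -> ev (contract p n b) w = ev b (p * w).
Proof.
move=> wn; rewrite -(poly_rV_K wn) rVpoly_sum mulr_sumr !linear_sum.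
apply: eq_bigr => i _ /=; rewrite -scalerAr !linearZ /=; congr (_ * _).
by rewrite ev_Xn mxE.
Qed.

(* The entries with [i + j >= L] are [0]. *)
Definition hankel m n L (b : 'rV[F]_L) : 'M[F]_(m, n) := \matrix_(i, j) ev b 'X^(i + j).

Lemma hankel_inj m n : (0 < m)%N || (n == 0)%N -> injective (@hankel m n.+1 (m + n)).
Proof.
move=> mn a a' /matrixP entries; apply/rowP => l; have ltl := ltn_ord l.
have lti : (minn l m.-1 < m)%N by lia.
have ltj : (l - minn l m.-1 < n.+1)%N by lia.
have := entries (Ordinal lti) (Ordinal ltj); rewrite !mxE /= subnKC ?geq_minl //.
by rewrite !ev_Xn.
Qed.

Lemma tr_hankel m n L (b : 'rV[F]_L) : (hankel m n b)^T = hankel n m b.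
Proof. by apply/matrixP => i j; rewrite !mxE addnC. Qed.

Lemma mul_rV_hankel m n L (b : 'rV[F]_L) (v : 'rV[F]_m) :
  v *m hankel m n b = contract (rVpoly v) n b.
Proof.
apply/rowP => j; rewrite !mxE rVpoly_sum mulr_suml linear_sum.
by apply: eq_bigr => i _; rewrite mxE -scalerAl linearZ /= exprD.
Qed.

(* No entry is left when [m = 0]. *)
Lemma mulp_hankel p m k n l L (b : 'rV[F]_L) :
    ((0 < m)%N -> (size p + m <= k.+1)%N && (m + n <= l.+1)%N) ->
  mulp_mx p m k *m hankel k n b = hankel m n (contract p l b).
Proof.
case: m => [|m] szs; first by rewrite [LHS]flatmx0 [RHS]flatmx0.
have /andP[pmk mnl] := szs isT.
apply/row_matrixP => i; rewrite !rowE mulmxA !mul_rV_hankel rVpoly_mulp //.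
apply/rowP => j; rewrite !mxE ev_contract ?mulrA ?[p * _]mulrC //.
rewrite rVpoly_delta -exprD size_polyXn.
by have := ltn_ord i; have := ltn_ord j; lia.
Qed.

End Functionals.

Section Annihilators.
Variables (F : fieldType) (L : nat) (b : 'rV[F]_L).
Implicit Types (p w : {poly F}) (k : nat).

(* The row space of [annih k] consists of the polynomials [p] of size at most [k]
   with [ev b (p * 'X^j) = 0] for [j + k <= L]: the bound [k] matters, and not only
   the size of [p]. *)
Definition annih k : 'M[F]_k := kermx (hankel k (L.+1 - k) b).

Lemma annihP k (v : 'rV[F]_k) :
  reflect (forall j, (j + k <= L)%N -> ev b (rVpoly v * 'X^j) = 0) (v <= annih k)%MS.
Proof.
apply: (iffP sub_kermxP); rewrite mul_rV_hankel => vb.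
  move=> j jk; have jlt : (j < L.+1 - k)%N by lia.
  by move/rowP/(_ (Ordinal jlt)): vb; rewrite !mxE.
by apply/rowP => j; rewrite !mxE vb //; have := ltn_ord j; lia.
Qed.

Lemma rank_annih_dual k : (k <= L.+1)%N ->
  (\rank (annih k) + (L.+1 - k) = \rank (annih (L.+1 - k)) + k)%N.
Proof.
move=> kL; rewrite !mxrank_ker subKn // -(tr_hankel k) mxrank_tr.
have := rank_leq_row (hankel k (L.+1 - k) b).
by have := rank_leq_col (hankel k (L.+1 - k) b); lia.
Qed.

Lemma rank_annih_full : \rank (annih L.+1) = L.+1.
Proof.
by have := rank_annih_dual (leqnn L.+1); rewrite subnn; have := rank_leq_row (annih 0); lia.
Qed.

Definition annih_next k : 'M[F]_k.+1 :=
  (annih k *m mulp_mx 1 k k.+1 + annih k *m mulp_mx 'X k k.+1)%MS.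

Lemma annih_next_sub k : (annih_next k <= annih k.+1)%MS.
Proof.
rewrite addsmx_sub; apply/andP; split; apply/rV_subP => _ /sub_mulmxP[v /annihP vb ->];
  apply/annihP => j jk; rewrite rVpoly_mulp ?size_poly1 ?size_polyX //.
  by rewrite mulr1 vb //; lia.
by rewrite -mulrA -exprS vb //; lia.
Qed.

(* If [p] and [p * 'X] are annihilators for the bound [k.+1], then [p] is one for [k]. *)
Lemma rank_annih_next k : (k < L)%N ->
  (\rank (annih k.+1) + \rank (annih k.+1) <= \rank (annih_next k.+1) + \rank (annih k))%N.
Proof.
move=> kL; pose I := mulp_mx (1 : {poly F}) k.+1 k.+2.
pose X := mulp_mx ('X : {poly F}) k.+1 k.+2.
have freeI : row_free I by rewrite mulp_mx_free ?oner_neq0 ?size_poly1.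
have freeX : row_free X by rewrite mulp_mx_free ?polyX_eq0 ?size_polyX.
rewrite -{1}(mxrankMfree (annih k.+1) freeI) -{1}(mxrankMfree (annih k.+1) freeX).
rewrite -mxrank_sum_cap leq_add2l.
rewrite -(mxrankMfree (annih k) (B := mulp_mx 'X k k.+2)); last first.
  by rewrite mulp_mx_free ?polyX_eq0 ?size_polyX //; lia.
apply: mxrankS; apply/rV_subP => z; rewrite sub_capmx => /andP[].
move=> /sub_mulmxP[v /annihP vb ->] /sub_mulmxP[u /annihP ub vu].
have vE : rVpoly v = rVpoly u * 'X.
  by move/(congr1 rVpoly): vu; rewrite !rVpoly_mulp ?size_poly1 ?size_polyX // mulr1.
have uk : (size (rVpoly u) <= k)%N.
  have [->|u0] := eqVneq (rVpoly u) 0; first by rewrite size_poly0.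
  by have := size_rVpoly v; rewrite vE size_mulX.
rewrite vu (_ : u *m X = poly_rV (rVpoly u) *m mulp_mx 'X k k.+2); last first.
  by apply: rVpoly_inj; rewrite !rVpoly_mulp ?size_polyX ?poly_rV_K //; lia.
apply: submxMr; apply/annihP => -[|j] jk; rewrite poly_rV_K //.
  exact: ub.
by rewrite exprS mulrA -vE vb //; lia.
Qed.

Lemma annih_deg_subproof : exists m, annih m.+1 != 0.
Proof. by exists L; rewrite -mxrank_eq0 rank_annih_full. Qed.

Definition annih_deg : nat := ex_minn annih_deg_subproof.

Local Notation r := annih_deg.
Local Notation R := (L.+1 - annih_deg)%N.

Lemma annih_deg_neq0 : annih r.+1 != 0.
Proof. by rewrite /annih_deg; case: ex_minnP. Qed.

Lemma annih_eq0 k : (k <= r)%N -> annih k = 0.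
Proof.
rewrite /annih_deg; case: ex_minnP => m _ minm; case: k => [|k] km; first exact: flatmx0.
by apply: contraTeq km => /minm; rewrite -ltnNge.
Qed.

Lemma annih_deg_leq : (r + r <= L.+1)%N.
Proof.
have rL : (r <= L.+1)%N.
  rewrite leqNgt; apply/negP => /ltnW/annih_eq0 full0.
  by have := rank_annih_full; rewrite full0 mxrank0.
by have := rank_annih_dual rL; rewrite annih_eq0 // mxrank0; lia.
Qed.

(* The increments of [\rank (annih k)] are nondecreasing by [rank_annih_next].  They
   are positive from [r] on, and sum to [R - r] between [r] and [R]. *)
Lemma rank_annih k : (k <= L.+1)%N -> \rank (annih k) = ((k - r) + (k - R))%N.
Proof.
have rL := annih_deg_leq; pose d k := \rank (annih k).
have d_dual j : (j <= L.+1)%N -> (d j + (L.+1 - j) = d (L.+1 - j) + j)%N.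
  exact: rank_annih_dual.
have d_small j : (j <= r)%N -> d j = 0%N by move=> jr; rewrite /d annih_eq0 // mxrank0.
have d_incr j : (r + j <= L)%N -> (d (r + j) < d (r + j).+1)%N.
  elim: j => [|j IHj] rjL.
    by rewrite addn0 d_small // lt0n mxrank_eq0 annih_deg_neq0.
  have := @rank_annih_next (r + j); have := mxrankS (annih_next_sub (r + j).+1).
  by rewrite addnS -!/(d _); lia.
have d_grow i j : (r + i + j <= L.+1)%N -> (d (r + i) + j <= d (r + i + j))%N.
  elim: j => [|j IHj] rijL; first by rewrite !addn0.
  by rewrite !addnS; have := d_incr (i + j)%N; rewrite addnA; lia.
move=> kL; rewrite -/(d k); have [kr|rk] := leqP k r; first by rewrite d_small //; lia.
have [Rk|kR] := leqP R k.
  by have := d_dual k kL; rewrite (d_small (L.+1 - k)%N); lia.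
have := d_grow 0%N (k - r)%N; have := d_grow (k - r)%N (R - k)%N.
have := d_dual r; rewrite (d_small r) // addn0 !subnKC; [|lia..].
by rewrite (d_small r) //; lia.
Qed.

Lemma annih_eq0E k : (k <= L.+1)%N -> (annih k == 0) = (k <= r)%N.
Proof. by move=> kL; rewrite -mxrank_eq0 rank_annih //; have := annih_deg_leq; lia. Qed.

Lemma mulp_annih_sub (f : {poly F}) k : (size f <= r.+1)%N ->
  (poly_rV f <= annih r.+1)%MS -> (mulp_mx f (k - r) k <= annih k)%MS.
Proof.
move=> fr /annihP; rewrite poly_rV_K // => fb; have [kr|rk] := leqP k r.
  by rewrite annih_eq0 // submx0 -mxrank_eq0 -leqn0 (leq_trans (rank_leq_row _)) // leqn0.
apply/rV_subP => v /sub_mulpP[|w wk vE]; first lia.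
apply/annihP => j jk; rewrite vE -(poly_rV_K wk) rVpoly_sum !mulr_suml linear_sum big1 // => i _.
rewrite -!scalerAl linearZ /= mulrAC -exprD [X in ev b X]mulrC fb ?mulr0 //.
by have := ltn_ord i; lia.
Qed.

Section Generators.
Variable f : {poly F}.
Hypotheses (f_neq0 : f != 0) (size_f : (size f <= r.+1)%N).
Hypothesis f_annih : (poly_rV f <= annih r.+1)%MS.

Lemma rank_mulp_gen k : \rank (mulp_mx f (k - r) k) = (k - r)%N.
Proof.
have [kr|rk] := leqP k r.
  by apply/eqP; have := rank_leq_row (mulp_mx f (k - r) k); lia.
by apply/eqP/mulp_mx_free => //; lia.
Qed.

Lemma annih_sub_gen k : (k <= R)%N -> (annih k <= mulp_mx f (k - r) k)%MS.
Proof.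
move=> kR; rewrite -(geq_leqif (mxrank_leqif_sup (mulp_annih_sub k size_f f_annih))).
by rewrite rank_mulp_gen rank_annih; lia.
Qed.

Lemma second_gen_exists : (0 < r)%N -> exists2 g : {poly F}, (size g <= R.+1)%N &
  (annih R.+1 <= mulp_mx f (R.+1 - r) R.+1 + (poly_rV g : 'rV_R.+1))%MS.
Proof.
move=> r0; have rL := annih_deg_leq.
have [|g spang] := submx_adds_row (mulp_annih_sub R.+1 size_f f_annih).
  by rewrite rank_mulp_gen rank_annih; lia.
by exists (rVpoly g); rewrite ?size_rVpoly ?rVpolyK.
Qed.

Lemma annih_sub_two_gens (g : {poly F}) : (size g <= R.+1)%N ->
    (annih R.+1 <= mulp_mx f (R.+1 - r) R.+1 + (poly_rV g : 'rV_R.+1))%MS ->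
  forall k, (R < k <= L.+1)%N ->
  (annih k <= mulp_mx f (k - r) k + mulp_mx g (k - R) k)%MS.
Proof.
move=> size_g spang k /andP[Rk kL]; have rL := annih_deg_leq.
elim: k => // k IHk in Rk kL *.
move: Rk; rewrite ltnS leq_eqVlt => /predU1P[<- {IHk}|Rk].
  apply: submx_trans spang _; rewrite addsmxS // subSnn.
  apply/sub_mulpP; first lia.
  by exists 1; rewrite ?size_poly1 ?mul1r ?poly_rV_K.
have annih_next_full : (annih k.+1 <= annih_next k)%MS.
  rewrite -(geq_leqif (mxrank_leqif_sup (annih_next_sub k))).
  case: k {IHk} => // k in Rk kL *; have := @rank_annih_next k.
  by rewrite !rank_annih; lia.
have next_sub (q : {poly F}) : (size q <= 2)%N ->
    (annih k *m mulp_mx q k k.+1 <= mulp_mx f (k.+1 - r) k.+1 + mulp_mx g (k.+1 - R) k.+1)%MS.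
  move=> q2; apply: submx_trans (submxMr _ (IHk Rk (ltnW kL))) _.
  rewrite addsmxMr !subSn; [|lia..].
  by rewrite addsmxS // mulp_mulp_sub //; lia.
by apply: submx_trans annih_next_full _; rewrite addsmx_sub !next_sub ?size_poly1 ?size_polyX.
Qed.

End Generators.

Definition gens_mx (f g : {poly F}) k : 'M[F]_(k - r + (k - R), k) :=
  col_mx (mulp_mx f (k - r) k) (mulp_mx g (k - R) k).

Lemma annih_sub_gens : exists f g : {poly F},
  [/\ (size f <= r.+1)%N, (size g <= R.+1)%N &
      forall k, (k <= L.+1)%N -> (annih k <= gens_mx f g k)%MS].
Proof.
have [v v_annih v0] := rowV0Pn annih_deg_neq0.
pose f := rVpoly v; have f_neq0 : f != 0 by rewrite rVpoly_eq0.
have f_annih : (poly_rV f <= annih r.+1)%MS by rewrite rVpolyK.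
have size_f : (size f <= r.+1)%N := size_rVpoly v.
have gens_low g k : (k <= R)%N -> (annih k <= gens_mx f g k)%MS.
  by move=> kR; rewrite -addsmxE (submx_trans (annih_sub_gen _ _ f_annih kR)) ?addsmxSl.
exists f; have [r0|r0] := posnP r.
  by exists 0; split; rewrite ?size_poly0 // => k kL; apply: gens_low; rewrite r0 subn0.
have [g size_g spang] := second_gen_exists f_neq0 size_f f_annih r0.
exists g; split=> // k kL; have [/gens_low//|Rk] := leqP k R.
by rewrite -addsmxE; apply: annih_sub_two_gens size_g spang _ _; rewrite ?Rk.
Qed.

(* Freeness comes from the dimensions: the number of rows of [gens_mx f g k] is the
   dimension of the space that they span. *)
Theorem annih_gens : exists f g : {poly F},
  [/\ (size f <= r.+1)%N, (size g <= R.+1)%N &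
      forall k, (k <= L.+1)%N -> row_free (gens_mx f g k) /\ (annih k :=: gens_mx f g k)%MS].
Proof.
have [f [g [size_f size_g spans]]] := annih_sub_gens; exists f, g; split=> // k kL.
have rank_gens : \rank (gens_mx f g k) = \rank (annih k).
  by apply/eqP; rewrite eqn_leq (mxrankS (spans k kL)) andbT rank_annih // rank_leq_row.
split; first by rewrite /row_free rank_gens rank_annih.
by apply/eqmxP; rewrite -(mxrank_leqif_eq (spans k kL)) rank_gens.
Qed.

End Annihilators.

Lemma hankel_free (F : fieldType) c n L (a : 'rV[F]_L) :
  (c + n = L.+1)%N -> row_free (hankel c n a) = (c <= annih_deg a)%N.
Proof.
move=> cnL; rewrite -annih_eq0E; last lia.
by rewrite /annih (_ : L.+1 - c = n)%N ?kermx_eq0 //; lia.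
Qed.

(* On the annihilators [f * w] and [g * u] of [b], the functional [a] acts through
   its contractions by [f] and [g], which form the row vector [a *m G^T]. *)
Lemma row_hankel_free (F : fieldType) s t k (b : 'rV[F]_(t + k)) : (s <= t.+1)%N ->
  let r := annih_deg b in let R := ((t + k).+1 - r)%N in
  exists2 G : 'M[F]_(s + k - r + (s + k - R), s + k), row_free G &
    forall a : 'rV_(s + k), row_free (row_mx (hankel k.+1 s a) (hankel k.+1 t b)) =
      row_free (col_mx (hankel (k.+1 - r) s (lsubmx (a *m G^T)))
                       (hankel (k.+1 - R) s (rsubmx (a *m G^T)))).
Proof.
move=> st r R; have [f [g [size_f size_g gens]]] := annih_gens b.
have rL := annih_deg_leq b.
exists (gens_mx b f g (s + k)) => [|a]; first by apply: (gens _ _).1; lia.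
have [free_gens annihE] : row_free (gens_mx b f g k.+1) /\
  (kermx (hankel k.+1 t b) :=: gens_mx b f g k.+1)%MS.
  by have := gens k.+1; rewrite /annih subSS addnK; apply; lia.
rewrite (row_free_row_mx _ free_gens annihE) mul_col_mx tr_col_mx mul_mx_row.
rewrite row_mxKl row_mxKr -!contractE.
by rewrite (mulp_hankel (l := s + k - r)) ?(mulp_hankel (l := s + k - R)) //; lia.
Qed.

(** * Counting over a finite field *)

Lemma sum_bool (T : finType) (P : pred T) : (\sum_x P x)%N = #|[set x | P x]|.
Proof. by rewrite -sum1dep_card [RHS]big_mkcond; apply: eq_bigr => x _; case: (P x). Qed.

Lemma card_pairs (A B : finType) (P : A -> B -> bool) :
  #|[set x | P x.1 x.2]| = (\sum_b #|[set a | P a b]|)%N.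
Proof.
under eq_bigr do rewrite -sum1dep_card.
by rewrite (exchange_big_dep predT) //= pair_big_dep /= sum1dep_card.
Qed.

Section Counting.
Variable F : finFieldType.
Local Notation q := #|F|.
Implicit Types (s t k m n c d L j : nat).

Lemma card_rV n : #|{: 'rV[F]_n}| = (q ^ n)%N.
Proof. by rewrite card_mx mul1n. Qed.

Lemma card_mulmx_eq0 m n (A : 'M[F]_(m, n)) :
  #|[set v : 'rV_m | v *m A == 0]| = (q ^ (m - \rank A))%N.
Proof.
by rewrite -mxrank_ker -card_rowg; apply: eq_card => v; rewrite mem_rowg inE sub_kermx.
Qed.

Lemma card_mulmx_preim m n (A : 'M[F]_(m, n)) (P : pred 'rV_n) : row_full A ->
  #|[set v : 'rV_m | P (v *m A)]| = (q ^ (m - n) * #|[set y | P y]|)%N.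
Proof.
move=> Afull; have /row_fullP[B BA] := Afull.
have fiber (y : 'rV_n) : #|[set v : 'rV_m | v *m A == y]| = (q ^ (m - n))%N.
  rewrite -[in RHS](eqP Afull) -card_mulmx_eq0 -[RHS](card_imset _ (addrI (y *m B))).
  apply: eq_card => v; rewrite !inE; apply/eqP/imsetP => [vA|[u]].
    exists (v - y *m B); last by rewrite addrC subrK.
    by rewrite inE mulmxBl -mulmxA BA mulmx1 vA subrr.
  by rewrite inE => /eqP uA ->; rewrite mulmxDl uA -mulmxA BA mulmx1 addr0.
rewrite -sum1_card (partition_big (mulmx^~ A) P) => [|v]; last by rewrite inE.
rewrite mulnC -sum_nat_const; apply: eq_big => [y|y Py]; first by rewrite inE.
rewrite -(fiber y) -sum1_card; apply: eq_bigl => v; rewrite !inE.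
by case: eqP => [->|]; rewrite ?Py ?andbF.
Qed.

Lemma card_hsubmx m n (P : 'rV[F]_m -> 'rV[F]_n -> bool) :
  #|[set y : 'rV_(m + n) | P (lsubmx y) (rsubmx y)]| = #|[set a : 'rV_m * 'rV_n | P a.1 a.2]|.
Proof.
have row_mx_inj : injective (fun a : 'rV[F]_m * 'rV[F]_n => row_mx a.1 a.2).
  by move=> [a1 a2] [c1 c2] /eq_row_mx[/= -> ->].
rewrite -(card_imset _ row_mx_inj); apply: eq_card => y; rewrite inE.
apply/idP/imsetP => [Py|[a]]; last by rewrite inE => Pa ->; rewrite row_mxKl row_mxKr.
by exists (lsubmx y, rsubmx y); rewrite ?inE //= hsubmxK.
Qed.

Lemma card_annihilated L k (v : 'rV[F]_k) : v != 0 -> (k <= L.+1)%N ->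
  #|[set b : 'rV_L | (v <= annih b k)%MS]| = (q ^ k.-1)%N.
Proof.
move=> v0 kL; pose A := mulp_mx (rVpoly v) (L.+1 - k) L.
have vp0 : rVpoly v != 0 by rewrite rVpoly_eq0.
have rankA : \rank A^T = (L.+1 - k)%N.
  rewrite mxrank_tr; apply/eqP/mulp_mx_free => //.
  by apply: leq_trans (leq_add (size_rVpoly v) (leqnn _)) _; lia.
have k0 : (0 < k)%N by apply: leq_trans (size_rVpoly v); rewrite lt0n size_poly_eq0.
rewrite (_ : k.-1 = L - \rank A^T)%N; last by rewrite rankA; lia.
rewrite -card_mulmx_eq0; apply: eq_card => b.
by rewrite !inE sub_kermx mul_rV_hankel contractE.
Qed.

Definition annih_moment L k : nat := (\sum_(b : 'rV[F]_L) q ^ \rank (annih b k))%N.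

Lemma annih_momentE L k : (k <= L.+1)%N ->
  (q * annih_moment L k + q ^ k = q ^ L.+1 + q ^ (2 * k))%N.
Proof.
move=> kL; have -> : annih_moment L k =
    (\sum_(v : 'rV_k) #|[set b : 'rV[F]_L | (v <= annih b k)%MS]|)%N.
  rewrite /annih_moment; under eq_bigr do rewrite -card_rowg -sum1_card.
  rewrite (exchange_big_dep predT) //=; apply: eq_bigr => v _; rewrite sum1dep_card.
  by apply: eq_card => b; rewrite !inE.
rewrite (bigD1 0) //= (eq_bigr (fun=> q ^ k.-1)%N) => [|v v0]; last exact: card_annihilated.
have -> : #|[set b : 'rV[F]_L | ((0%R : 'rV_k) <= annih b k)%MS]| = (q ^ L)%N.
  by rewrite -card_rV; apply: eq_card => b; rewrite inE sub0mx.
rewrite sum_nat_const (_ : #|_| = (q ^ k).-1)%N; last by rewrite -card_rV -(cardC1 0).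
have q0 : (0 < q ^ k)%N by rewrite -card_rV; apply/card_gt0P; exists 0.
rewrite mulnDr -expnS -addnA; congr (_ + _)%N.
case: k {kL} q0 => [|k] q0; first by rewrite expn0 mul0n muln0.
by rewrite mulnCA -expnS addnC -mulSn prednK // mul2n -addnn expnD.
Qed.

Lemma annih_momentS L k : (k <= L)%N ->
  (annih_moment L k.+1 + q ^ k = q ^ L + q ^ (2 * k).+1)%N.
Proof.
move=> kL; apply/eqP; rewrite -(eqn_pmul2l (ltnW (card_finNzRing_gt1 F))) !mulnDr -!expnS.
by rewrite annih_momentE // mulnS.
Qed.

Lemma card_annih_deg_leq L j :
  #|[set b : 'rV[F]_L | annih_deg b <= j]%N| = (q ^ minn (2 * j) L)%N.
Proof.
have [jL|Lj] := leqP (2 * j) L; last first.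
  rewrite -card_rV -cardsT; apply: eq_card => b; rewrite !inE.
  by have := annih_deg_leq b; lia.
have q1 : (1 < q)%N := card_finNzRing_gt1 F.
have : (\sum_(b : 'rV[F]_L) (q ^ \rank (annih b j.+1) + q + (annih_deg b <= j)) =
        \sum_(b : 'rV[F]_L) (q * q ^ \rank (annih b j) + q * (annih_deg b <= j) + 1))%N.
  apply: eq_bigr => b _.
  have rank_low k : (k <= j.+1)%N -> \rank (annih b k) = (k - annih_deg b)%N.
    by move=> kj; have rL := annih_deg_leq b; rewrite rank_annih; lia.
  rewrite !rank_low //; case: leqP => [rj|jr]; first by rewrite subSn // expnS; lia.
  by have [-> ->] : (j.+1 - annih_deg b = 0 /\ j - annih_deg b = 0)%N; lia.
rewrite !big_split /= -!big_distrr /= !sum_nat_const card_rV muln1 -!/(annih_moment L _).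
have moment_next := @annih_momentS L j; have moment := @annih_momentE L j.
rewrite !expnS in moment moment_next; rewrite sum_bool; move: #|[set _ | _]| => n sums.
have cancel m : (q * n + m = q * m + n)%N -> n = m by nia.
by apply: cancel; move: q sums moment moment_next => p; lia.
Qed.

Lemma card_annih_deg_eq L j :
  #|[set b : 'rV[F]_L | annih_deg b == j.+1]|
  = (q ^ minn (2 * j.+1) L - q ^ minn (2 * j) L)%N.
Proof.
rewrite -!card_annih_deg_leq.
rewrite -(cardsID [set b : 'rV[F]_L | annih_deg b <= j]%N [set b | _ <= j.+1]%N).
rewrite (_ : _ :&: _ = [set b : 'rV[F]_L | annih_deg b <= j]%N) ?addKn.
  by apply: eq_card => b; rewrite !inE -ltnNge eqn_leq andbC.
by apply/setP => b; rewrite !inE; lia.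
Qed.

Lemma card_annih_deg_shift L j :
  #|[set b : 'rV[F]_(L + 4) | annih_deg b == j.+3]|
  = (q ^ 4 * #|[set b : 'rV[F]_L | annih_deg b == j.+1]|)%N.
Proof.
rewrite !card_annih_deg_eq mulnBr -!expnD.
by congr (q ^ _ - q ^ _)%N; lia.
Qed.

Lemma sum_annih_deg L B (G : nat -> nat) : (L < B)%N ->
  (\sum_(b : 'rV[F]_L) G (annih_deg b)
   = \sum_(r < B) #|[set b : 'rV[F]_L | annih_deg b == r]| * G r)%N.
Proof.
move=> LB; have ltB (b : 'rV[F]_L) : (annih_deg b < B)%N by have := annih_deg_leq b; lia.
rewrite (partition_big (fun b => Ordinal (ltB b)) predT) //=; apply: eq_bigr => r _.
rewrite -sum_nat_const; apply: eq_big => b; first by rewrite inE.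
by move=> /eqP/(congr1 val) /= ->.
Qed.

(** * Pairs of Hankel matrices *)

Definition free_row_pairs s t k : nat :=
  #|[set ab : 'rV[F]_(s + k) * 'rV[F]_(t + k) |
     row_free (row_mx (hankel k.+1 s ab.1) (hankel k.+1 t ab.2))]|.

Definition free_col_pairs s c d m n : nat :=
  #|[set a : 'rV[F]_m * 'rV[F]_n | row_free (col_mx (hankel c s a.1) (hankel d s a.2))]|.

Lemma free_row_pairsC s t k : free_row_pairs s t k = free_row_pairs t s k.
Proof.
rewrite /free_row_pairs -(card_imset _ (can_inj swap_pairK)).
rewrite (can2_imset_pre _ swap_pairK swap_pairK); apply: eq_card => -[b a].
by rewrite !inE row_free_row_mxC.
Qed.

(* With [R = t + k + 1 - r], [r - t] is [k + 1 - R] and [s + r - t.+1] is [s + k - R]. *)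
Definition completions s t k r : nat :=
  (q ^ (s + k - (s + k - r + (s + r - t.+1)))
   * free_col_pairs s (k.+1 - r) (r - t) (s + k - r) (s + r - t.+1))%N.

Lemma card_row_hankel_free s t k (b : 'rV[F]_(t + k)) : (s <= t.+1)%N ->
  #|[set a : 'rV[F]_(s + k) | row_free (row_mx (hankel k.+1 s a) (hankel k.+1 t b))]|
  = completions s t k (annih_deg b).
Proof.
move=> st; have [G Gfree freeE] := row_hankel_free b st; have rL := annih_deg_leq b.
pose P c d m n (a1 : 'rV[F]_m) (a2 : 'rV[F]_n) :=
  row_free (col_mx (hankel c s a1) (hankel d s a2)).
under eq_finset do rewrite freeE -/(P _ _ _ _ _ _).
rewrite (card_mulmx_preim (fun y => P _ _ _ _ (lsubmx y) (rsubmx y))) /row_full ?mxrank_tr //.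
rewrite card_hsubmx /completions /free_col_pairs.
have -> : (k.+1 - ((t + k).+1 - annih_deg b) = annih_deg b - t)%N by lia.
by have -> : (s + k - ((t + k).+1 - annih_deg b) = s + annih_deg b - t.+1)%N by lia.
Qed.

Lemma free_row_pairs_sum s t k : (s <= t.+1)%N ->
  free_row_pairs s t k = (\sum_(b : 'rV[F]_(t + k)) completions s t k (annih_deg b))%N.
Proof.
move=> st.
rewrite /free_row_pairs (card_pairs (fun a b => row_free (row_mx (hankel _ s a) (hankel _ t b)))).
by apply: eq_bigr => b _; apply: card_row_hankel_free.
Qed.

Lemma completions_eq0 s t k r : (r + s <= k)%N -> completions s t k r = 0%N.
Proof.
move=> rsk; apply/eqP; rewrite muln_eq0 cards_eq0 orbC; apply/orP; left.
apply/eqP/setP => a; rewrite !inE; apply/negP => /eqP free.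
have := rank_leq_col (col_mx (hankel (k.+1 - r) s a.1) (hankel (r - t) s a.2)).
by rewrite free; lia.
Qed.

Lemma completions_shift s t k r : (s <= t.+1)%N -> (r <= t + k)%N ->
  completions s t.+2 k.+2 r.+2 = (q ^ 2 * completions s t k r)%N.
Proof.
move=> st rtk; rewrite /completions !addnS !subSS mulnA -expnD.
by congr (q ^ _ * _)%N; lia.
Qed.

Lemma free_row_pairs_shift s t k : (s <= k)%N -> (s <= t.+1)%N ->
  free_row_pairs s t.+2 k.+2 = (q ^ 6 * free_row_pairs s t k)%N.
Proof.
move=> sk st; rewrite !free_row_pairs_sum ?(leqW (leqW _)) //.
have [B ltB] : exists B, (t + k + 1 < B)%N by exists (t + k).+2; lia.
rewrite (@sum_annih_deg _ B.+3) ?(@sum_annih_deg _ B.+1 (completions _ _ _)); try lia.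
rewrite !big_ord_recl /= /bump /= !add1n !completions_eq0 ?muln0 ?add0n; try lia.
rewrite big_distrr /=; apply: eq_bigr => i _.
rewrite (_ : t.+2 + k.+2 = t + k + 4)%N ?card_annih_deg_shift; last lia.
have [itk|tki] := leqP i.+1 (t + k); first by rewrite completions_shift // mulnACA -expnD.
rewrite (_ : #|[set b : 'rV[F]_(t + k) | annih_deg b == i.+1]| = 0%N) ?mul0n ?muln0 //.
apply/eqP; rewrite cards_eq0; apply/eqP/setP => b; rewrite !inE.
by apply/eqP; have := annih_deg_leq b; lia.
Qed.

Lemma card_hankel_free n j : (j <= n)%N ->
  (#|[set a : 'rV[F]_(n + j) | row_free (hankel j.+1 n a)]| + q ^ (2 * j) = q ^ (n + j))%N.
Proof.
move=> jn; have <- : #|[set a : 'rV[F]_(n + j) | annih_deg a <= j]%N| = (q ^ (2 * j))%N.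
  by rewrite card_annih_deg_leq; congr (q ^ _)%N; lia.
rewrite -card_rV -cardsT -(cardsID [set a : 'rV[F]_(n + j) | annih_deg a <= j]%N setT).
rewrite addnC setTI; congr (_ + _)%N; apply: eq_card => a; rewrite !inE andbT -ltnNge.
by apply: hankel_free; lia.
Qed.

Lemma free_col_pairs0 s c m n :
  free_col_pairs s c 0 m n = (#|[set a : 'rV[F]_m | row_free (hankel c s a)]| * q ^ n)%N.
Proof.
rewrite -card_rV -cardsT -cardsX; apply: eq_card => -[a1 a2].
by rewrite !inE andbT /row_free -addsmxE flatmx0 addsmx0 addn0.
Qed.

Lemma completions_low s t r j : (s <= t.+1)%N -> (r <= t)%N -> (j <= s)%N ->
  (completions s t (r + j) r + q ^ (r + 2 * j) = q ^ (s + (r + j)))%N.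
Proof.
move=> st rt js; rewrite /completions.
have -> : ((r + j).+1 - r = j.+1)%N by lia.
have -> : (s + (r + j) - r = s + j)%N by lia.
rewrite (eqP (rt : r - t == 0)%N) free_col_pairs0 mulnCA -expnD.
have -> : (s + (r + j) - (s + j + (s + r - t.+1)) + (s + r - t.+1) = r)%N by lia.
by rewrite mulnC expnD -mulnDr card_hankel_free // -expnD; congr (q ^ _)%N; lia.
Qed.

Lemma completions_top s t k r : (s <= t.+1)%N -> (k < r <= t)%N ->
  completions s t k r = (q ^ (s + k))%N.
Proof.
move=> st /andP[kr rt]; rewrite /completions (eqP (rt : r - t == 0)%N) free_col_pairs0.
rewrite (eqP (kr : k.+1 - r == 0)%N) (_ : #|_| = q ^ (s + k - r))%N.
  by rewrite -!expnD; congr (q ^ _)%N; lia.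
by rewrite -card_rV -cardsT; apply: eq_card => a; rewrite !inE /row_free flatmx0 mxrank0.
Qed.

(* The last terms on both sides account for [b = 0] when [k = s.+1]: [completions] is
   then [0], whereas the remaining terms would give it a negative value. *)
Lemma completions_affine s t k r : (s <= t.+1)%N -> (k <= s.+1)%N -> (r <= t)%N ->
  (q * completions s t k r + q ^ k * q ^ (k.+1 - r) + (r <= k) * q ^ k + (r + s < k) * q ^ (2 * k)
   = q ^ (s + k).+1 + q ^ k + (r + s < k) * q ^ (2 * k).+1)%N.
Proof.
move=> st ks rt; have [kr|rk] := ltnP k r.
  rewrite completions_top ?kr // (eqP (kr : k.+1 - r == 0)%N) (_ : r + s < k = false)%N; last lia.
  by rewrite -expnS muln1 !addn0.
have [rs_lt_k|k_le_rs] := boolP (r + s < k)%N.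
  rewrite completions_eq0; last lia.
  have [-> ->] : (r = 0 /\ k = s.+1)%N by lia.
  rewrite subn0 -expnD !mul1n muln0 add0n.
  have -> : (s.+1 + s.+2 = (2 * s.+1).+1)%N by lia.
  by have -> : ((s + s.+1).+1 = 2 * s.+1)%N; lia.
rewrite !mul0n !addn0 mul1n -(subnKC rk) -addnS addKn; congr (_ + _)%N.
rewrite !expnS -(@completions_low s t r (k - r)) //; last lia.
by rewrite mulnDr mulnCA -expnD; congr (_ + _ * q ^ _)%N; lia.
Qed.

Lemma free_row_pairs_small s t k : (s <= t.+1)%N -> (k <= t)%N -> (k <= s.+1)%N ->
  (q * free_row_pairs s t k + q ^ (3 * k).+1 + q ^ (3 * k) + (k == s.+1) * q ^ (2 * k)
   = q ^ (s + t + 2 * k).+1 + q ^ (2 * k) + (k == s.+1) * q ^ (2 * k).+1)%N.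
Proof.
move=> st kt ks.
have count_small : (\sum_(b : 'rV[F]_(t + k)) (annih_deg b <= k) = q ^ (2 * k))%N.
  by rewrite sum_bool card_annih_deg_leq; congr (q ^ _)%N; lia.
have count_zero : (\sum_(b : 'rV[F]_(t + k)) (annih_deg b + s < k) = (k == s.+1))%N.
  have [kE|kE] := eqVneq k s.+1; last by rewrite big1 // => b _; apply/eqP; rewrite eqb0; lia.
  transitivity #|[set b : 'rV[F]_(t + k) | annih_deg b <= 0]%N|.
    by rewrite sum_bool; apply: eq_card => b; rewrite !inE; lia.
  by rewrite card_annih_deg_leq muln0 min0n.
have : (\sum_(b : 'rV[F]_(t + k))
        (q * completions s t k (annih_deg b) + q ^ k * q ^ \rank (annih b k.+1)
         + (annih_deg b <= k) * q ^ k + (annih_deg b + s < k) * q ^ (2 * k))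
    = \sum_(b : 'rV[F]_(t + k))
        (q ^ (s + k).+1 + q ^ k + (annih_deg b + s < k) * q ^ (2 * k).+1))%N.
  apply: eq_bigr => b _; have rL := annih_deg_leq b.
  have rt : (annih_deg b <= t)%N by lia.
  rewrite -(completions_affine st ks rt) (_ : \rank _ = k.+1 - annih_deg b)%N //.
  by rewrite rank_annih; lia.
rewrite !big_split /= -!big_distrr -!big_distrl /= -free_row_pairs_sum // -/(annih_moment _ _).
rewrite count_small count_zero !sum_nat_const card_rV => sums.
have := congr1 (muln (q ^ k)) (annih_momentS (leq_addl t k)).
rewrite !mulnDr; move: sums; rewrite -!expnD.
have -> : (2 * k + k = 3 * k)%N by lia.
have -> : (t + k + (s + k).+1 = (s + t + 2 * k).+1)%N by lia.
have -> : (k + (2 * k).+1 = (3 * k).+1)%N by lia.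
rewrite addnn -mul2n [(k + (t + k))%N]addnC.
by move: q => p; lia.
Qed.

Lemma free_row_pairs_large s n : (n <= s)%N ->
  (q * free_row_pairs s s.+1 (s + n).+1 + q ^ (3 * (s + n) + 4) + q ^ (3 * (s + n) + 3)
   = q ^ (4 * s + 2 * n + 4) + q ^ (2 * s + 4 * n + 3))%N.
Proof.
elim: n s => [|n IHn] s ns.
  rewrite addn0; have := @free_row_pairs_small s s.+1 s.+1 (leqW (leqnSn s)) (leqnn _) (leqnn _).
  rewrite eqxx !mul1n.
  have -> : ((3 * s.+1).+1 = 3 * s + 4)%N by lia.
  have -> : (3 * s.+1 = 3 * s + 3)%N by lia.
  have -> : ((s + s.+1 + 2 * s.+1).+1 = 4 * s + 2 * 0 + 4)%N by lia.
  have -> : ((2 * s.+1).+1 = 2 * s + 4 * 0 + 3)%N by lia.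
  by move: q => p; lia.
case: s ns => // s ns; rewrite addSn addnS.
rewrite free_row_pairs_shift ?ltnS ?leq_addr // free_row_pairsC mulnCA.
have shift a b : a = (6 + b)%N -> (q ^ a = q ^ 6 * q ^ b)%N by move=> ->; rewrite expnD.
rewrite (shift (3 * (s + n).+2 + 4) (3 * (s + n) + 4))%N; last lia.
rewrite (shift (3 * (s + n).+2 + 3) (3 * (s + n) + 3))%N; last lia.
rewrite (shift (4 * s.+1 + 2 * n.+1 + 4) (4 * s + 2 * n + 4))%N; last lia.
rewrite (shift (2 * s.+1 + 4 * n.+1 + 3) (2 * s + 4 * n + 3))%N; last lia.
by rewrite -!mulnDr IHn.
Qed.

End Counting.

(** * Matrices over F_2 *)

Lemma persymmetricP m n (A : 'M['F_2]_(m, n.+1)) :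
  reflect (exists a : 'rV['F_2]_(m + n), A = hankel m n.+1 a) (persymmetric A).
Proof.
apply: (iffP forallP) => [persA|[a ->] i1]; last first.
  apply/forallP => j1; apply/forallP => i2; apply/forallP => j2.
  by apply/implyP => /eqP ij; rewrite !mxE ij.
exists (\row_l oapp (fun x : 'I_m * 'I_n.+1 => A x.1 x.2) 0
         [pick x : 'I_m * 'I_n.+1 | (x.1 + x.2 == l)%N]).
apply/matrixP => i j; have ltl : (i + j < m + n)%N by have := ltn_ord i; have := ltn_ord j; lia.
rewrite mxE (ev_Xn _ (Ordinal ltl)) mxE.
case: pickP => [[i' j'] /= /eqP ij|/(_ (i, j))]; last by rewrite /= eqxx.
have /forallP/(_ j')/forallP/(_ i)/forallP/(_ j) := persA i'.
by rewrite ij eqxx => /eqP ->.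
Qed.

Lemma Gamma_free_row_pairs s t k : (0 < s)%N || (k == 0)%N -> (0 < t)%N || (k == 0)%N ->
  Gamma s t k.+1 k.+1 = free_row_pairs 'F_2 s t k.
Proof.
move=> hs ht; pose stack (ab : 'rV['F_2]_(s + k) * 'rV_(t + k)) :=
  col_mx (hankel s k.+1 ab.1) (hankel t k.+1 ab.2).
have stack_inj : injective stack.
  by move=> [a b] [a' b'] /eq_col_mx[/(hankel_inj hs) /= -> /(hankel_inj ht) /= ->].
have rank_stack ab : (\rank (stack ab) == k.+1) =
    row_free (row_mx (hankel k.+1 s ab.1) (hankel k.+1 t ab.2)).
  by rewrite /row_free -mxrank_tr tr_col_mx !tr_hankel.
rewrite /free_row_pairs -[RHS](card_imset _ stack_inj); apply: eq_card => M; rewrite inE.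
apply/and3P/imsetP => [[/persymmetricP[a aE] /persymmetricP[b bE] rankM]|[[a b]]].
  have ME : M = stack (a, b) by rewrite /stack /= -aE -bE vsubmxK.
  by exists (a, b); rewrite // inE -rank_stack -ME.
rewrite inE -rank_stack => rank_ab ->; split=> //.
  by rewrite col_mxKu; apply/persymmetricP; exists a.
by rewrite col_mxKd; apply/persymmetricP; exists b.
Qed.

Lemma double_exp2z (R : numFieldType) (e : int) (n : nat) :
  e + 1 = n%:Z -> 2 * (2 : R) ^ e = (2 ^ n)%:R.
Proof.
by move=> en; rewrite -{1}[2 : R]expr1z -expfzDr ?pnatr_eq0 // addrC en natrX.
Qed.

Lemma natr_of_double (R : numFieldType) (n a b c : nat) (x y z : R) :
    (2 * n + 3 * b = a + c)%N -> 2 * x = a%:R -> 2 * y = b%:R -> 2 * z = c%:R ->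
  n%:R = x - 3 * y + z.
Proof.
move=> /(congr1 (fun m => m%:R : R)) /=; rewrite natrD [in RHS]natrD !natrM => count xa yb zc.
apply: (@mulfI _ (2 : R)); first by rewrite pnatr_eq0.
rewrite mulrDr mulrBr mulrCA xa yb zc.
by apply/eqP; rewrite addrAC -count addrK.
Qed.

(* Powers of 2 are taken in rat with integer exponents, because 3i - 4 and
   2i - 3 are negative for i = 1.  In the second case the leading exponent is
   2s + 2i - 1; the source prints 2s + 2i - 2, a misprint (for s = 1, i = 3 the
   printed expression equals -16, while the number of matrices is 48). *)
Theorem theorem2p12 (s i : nat) :
  ((1 <= i <= s + 1)%N ->
     (Gamma s (s + 1) i i)%:R =
       (2 : rat) ^ (2 * s%:Z + 2 * i%:Z - 1)
       - 3 * (2 : rat) ^ (3 * i%:Z - 4)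
       + (2 : rat) ^ (2 * i%:Z - 3))
  /\
  ((s + 2 <= i <= 2 * s + 1)%N ->
     (Gamma s (s + 1) i i)%:R =
       (2 : rat) ^ (2 * s%:Z + 2 * i%:Z - 1)
       - 3 * (2 : rat) ^ (3 * i%:Z - 4)
       + (2 : rat) ^ (4 * i%:Z - 2 * s%:Z - 6)).
Proof.
split=> [/andP[i0 is1]|/andP[si i2s]].
  case: i i0 is1 => // k _ ks; rewrite addn1 Gamma_free_row_pairs; [|lia..].
  apply: (natr_of_double (a := 2 ^ (s + s.+1 + 2 * k).+1) (b := 2 ^ (3 * k)) (c := 2 ^ (2 * k)));
    try by apply: double_exp2z; lia.
  have := @free_row_pairs_small 'F_2 s s.+1 k.
  by rewrite card_Fp // (_ : k == s.+1 = false) ?expnS; lia.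
have [n iE] : exists n, i = (s + n).+2 by exists (i - (s + 2))%N; lia.
rewrite iE addn1 Gamma_free_row_pairs; [|lia..].
apply: (natr_of_double (a := 2 ^ (4 * s + 2 * n + 4)) (b := 2 ^ (3 * (s + n) + 3))
  (c := 2 ^ (2 * s + 4 * n + 3))); try by apply: double_exp2z; lia.
have := @free_row_pairs_large 'F_2 s n; rewrite card_Fp //.
by rewrite (_ : 3 * (s + n) + 4 = (3 * (s + n) + 3).+1)%N ?expnS; lia.
Qed.
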